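(* Suppose that a non-discrete paratopological group $(H,\tau)$ contains an infinite central subgroup $G$ such that, with respect to the subspace topology $\tau\upharpoonright_G$, either $G$ is discrete or there is a paratopological group topology on $G$ transversal to $\tau\upharpoonright_G$. Then there is a paratopological group topology on $H$ transversal to $\tau$.
   Context: A paratopological group is a group with a topology for which multiplication is jointly continuous (no separation axiom is assumed); such a topology is called a paratopological group topology. Two non-discrete topologies on a set are transversal if their union generates the discrete topology. *)

(* Defs.v *)
From HB Require Import structures.
From mathcomp Require Import all_boot.
From mathcomp Require Import all_classical topology.

Set Implicit Arguments.
Unset Strict Implicit.
Unset Printing Implicit Defensive.

Local Open Scope classical_set_scope.

(* As for [sup_topology], a topology on a type [T] is a term of type
   [Topological T], and [Topological.Pack tau] is [T] equipped with [tau].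
   The choice structure that [Topological T] also carries plays no role. *)

Definition is_discrete (T : Type) (tau : Topological T) : Prop :=
  forall A : set (Topological.Pack tau), open A.

Definition subspace_top (S T : choiceType) (i : S -> T) (tau : Topological T) :
    Topological S :=
  Topological.class (initial_topology (i : S -> Topological.Pack tau)).

(* The topology with subbase the union of the two families of open sets. *)
Definition join_top (T : choiceType) (tau sigma : Topological T) :
    Topological T :=
  Topological.class (sup_topology (fun b : bool => if b then tau else sigma)).

Definition transversal_top (T : choiceType) (tau sigma : Topological T) : Prop :=
  [/\ ~ is_discrete tau, ~ is_discrete sigma
    & is_discrete (join_top tau sigma)].

(* Joint continuity of multiplication; [*] on pairs of spaces is the product
   topology. *)
Definition paratopological_group (H : groupType) (tau : Topological H) : Prop :=
  continuous (fun xy : Topological.Pack tau * Topological.Pack tau =>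
    (@mul H xy.1 xy.2 : Topological.Pack tau)).

(* Main.v *)
From HB Require Import structures.
Require Import Defs.
From mathcomp Require Import all_boot.
From mathcomp Require Import all_classical topology.

(** Spread a topology of the central subgroup [G] over all cosets of [G]: a set
    is open when its trace on each coset, translated back to [G], is open.
    Centrality makes multiplication continuous, [G] becomes open, and hence any
    topology on [H] whose trace on [G] joins with the given one to the discrete
    topology already joins with the extended one to the discrete topology. When
    [G] is discrete in [H], the indiscrete topology on [G] can be extended, as
    no separation is required. *)

Set Implicit Arguments.
Unset Strict Implicit.
Unset Printing Implicit Defensive.

Local Open Scope classical_set_scope.
Local Open Scope group_scope.

(** An alias of [H] that remembers [sigma], so that the new topology can be attached to it as a
    canonical instance. *)
Definition coset_topology (H : groupType) (P : {pred H}) (G : subGroupType P)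
  (sigma : Topological G) : Type := H.

Section CosetTopology.
Variables (H : groupType) (P : {pred H}) (G : subGroupType P).
Variable sigma : Topological G.

(** Letting [x] run over all of [H] avoids choosing coset representatives. *)
Definition coset_open (U : set H) : Prop :=
  forall x : H, @open (Topological.Pack sigma) [set g | U (x * val g)].

Let coset_openT : coset_open setT.
Proof. by move=> x; exact: openT. Qed.

Let coset_openI : setI_closed coset_open.
Proof. by move=> U V oU oV x; exact: openI (oU x) (oV x). Qed.

Let coset_open_bigU (I : Type) (F : I -> set H) :
  (forall i, coset_open (F i)) -> coset_open (\bigcup_i F i).
Proof. by move=> oF x; apply: bigcup_open => i _; exact: oF. Qed.

HB.instance Definition _ := Choice.copy (coset_topology sigma) H.
HB.instance Definition _ := isOpenTopological.Build (coset_topology sigma)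
  coset_openT coset_openI coset_open_bigU.

End CosetTopology.

Definition coset_top (H : groupType) (P : {pred H}) (G : subGroupType P)
    (sigma : Topological G) : Topological H :=
  Topological.class (coset_topology sigma).

Section Joins.
Variables (T : choiceType) (tau sigma : Topological T).

(** The supersets of the sets [U] meet [V] form a filter that converges to [x] in both topologies,
    hence in their supremum. *)
Lemma nbhs_joinP (x : T) (A : set T) :
  nbhs (x : Topological.Pack (join_top tau sigma)) A <->
  exists U V : set T, [/\ nbhs (x : Topological.Pack tau) U,
    nbhs (x : Topological.Pack sigma) V & U `&` V `<=` A].
Proof.
have sup_cvg := @cvg_sup T bool (fun b => if b then tau else sigma).
split; last first.
  have xJ := (sup_cvg _ x (nbhs_filter (x : Topological.Pack
    (join_top tau sigma)))).1 (fun _ => id).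
  by case=> U [V [/(xJ true) xU /(xJ false) xV]] /filterS; apply; exact: filterI.
pose F : set_system T := filter_from
  [set UV : set T * set T | nbhs (x : Topological.Pack tau) UV.1 /\
                            nbhs (x : Topological.Pack sigma) UV.2]
  (fun UV => UV.1 `&` UV.2).
have F_filter : Filter F.
  apply: filter_from_filter; first by exists (setT, setT); split; exact: filterT.
  move=> [U V] [U' V'] [/= xU xV] [/= xU' xV'].
  exists (U `&` U', V `&` V'); first by split; exact: filterI.
  by move=> y [[? ?] [? ?]].
have Fx : forall b : bool,
    F --> (x : Topological.Pack (if b then tau else sigma)).
  case=> U xU; first by exists (U, setT) => [|y []//]; split=> //; exact: filterT.
  by exists (setT, U) => [|y []//]; split=> //; exact: filterT.
by move/((sup_cvg _ x F_filter).2 Fx) => [[U V] [xU xV] UVA]; exists U, V.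
Qed.

Lemma discrete_joinl : is_discrete tau -> is_discrete (join_top tau sigma).
Proof.
move=> tau_discrete A; rewrite openE => x Ax; apply/nbhs_joinP.
exists A, setT; split; last by move=> y [].
  exact: (@open_nbhs_nbhs (Topological.Pack tau)).
exact: filterT.
Qed.

End Joins.

Section Paratopological.
Variables (H : groupType) (tau : Topological H).
Hypothesis tau_para : paratopological_group tau.

Lemma nbhs_mul (x y : H) (W : set H) :
  nbhs (x * y : Topological.Pack tau) W ->
  exists A B : set H, [/\ nbhs (x : Topological.Pack tau) A,
    nbhs (y : Topological.Pack tau) B & forall a b, A a -> B b -> W (a * b)].
Proof.
move=> /(tau_para (x := (x, y))) [[A B] [/= xA yB] ABW].
by exists A, B; split=> // a b Aa Bb; exact: (ABW (a, b)).
Qed.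

Lemma nbhs_translate (x y : H) (W : set H) :
  nbhs (x * y : Topological.Pack tau) W ->
  nbhs (y : Topological.Pack tau) [set z | W (x * z)].
Proof.
move=> /nbhs_mul[A [B [xA yB ABW]]]; apply: filterS yB => b Bb.
by apply: ABW => //; exact: nbhs_singleton xA.
Qed.

End Paratopological.

Section CosetExtension.
Variables (H : groupType) (P : {pred H}) (G : subGroupType P).
Variable sigma : Topological G.

(** Taking the trace at the representative [1] recovers any subset of [G] from its image in [H]. *)
Lemma coset_top_nondiscrete :
  ~ is_discrete sigma -> ~ is_discrete (coset_top sigma).
Proof.
move=> sigma_nd coset_d; apply: sigma_nd => A.
have := coset_d [set val g | g in A] 1; congr open.
rewrite predeqE => g; rewrite /= mul1g; split=> [[k Ak /val_inj <-]//|Ag].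
by exists g.
Qed.

Hypothesis sigma_para : paratopological_group sigma.

(** Translations of [G] are continuous for [sigma], so [x * B] is coset-open whenever [B] is open in
    [G]. *)
Lemma nbhs_cosetP (x : H) (W : set H) :
  nbhs (x : Topological.Pack (coset_top sigma)) W <->
  nbhs (1 : Topological.Pack sigma) [set g : G | W (x * val g)].
Proof.
rewrite !nbhsE; split=> [[U [oU Ux] UW]|[B [oB B1] BW]].
  exists [set g : G | U (x * val g)]; last by move=> g /UW.
  by split; [exact: oU|rewrite /= val1 mulg1].
exists [set x * val g | g in B]; last by move=> _ [g Bg <-]; exact: BW.
split; last by exists 1 => //; rewrite val1 mulg1.
move=> y; rewrite openE => g [g0 Bg0 xg0E].
(* From [x * val g0 = y * val g] it follows that [y * val k = x * val (g0 * g^-1 * k)]. *)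
have : nbhs (g : Topological.Pack sigma) [set k | B (g0 * g^-1 * k)].
  apply: nbhs_translate => //; rewrite mulgVK.
  exact: (@open_nbhs_nbhs (Topological.Pack sigma)).
apply: filterS => k Bk; exists (g0 * g^-1 * k) => //.
by rewrite !valM !mulgA xg0E -!mulgA -!valM mulVKg.
Qed.

(** By centrality [(x * a) * (y * b) = (x * y) * (a * b)] for [a], [b] in [G], so continuity at
    [(x, y)] reduces to continuity of the product of [G] at [(1, 1)]. *)
Lemma coset_top_paratopological :
  {in P, forall g : H, forall h : H, commute g h} ->
  paratopological_group (coset_top sigma).
Proof.
move=> G_central [x y] W /nbhs_cosetP /=.
rewrite -[X in nbhs X _]mulg1 => /(nbhs_mul sigma_para)[A [B [A1 B1 ABW]]].
exists ([set x * val g | g in A], [set y * val g | g in B]); last first.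
  move=> [_ _] [/= [a Aa <-] [b Bb <-]].
  rewrite mulgA -(mulgA x) (G_central _ (valP a)) mulgA -mulgA -valM.
  exact: ABW.
split; apply/nbhs_cosetP; [apply: filterS A1|apply: filterS B1] => g ?.
  by exists g.
by exists g.
Qed.

(** If [U] open in [H] and [V] inside [G] meet only in [1], then [x * U] and [x * V] meet only in
    [x]; the second factor confines the intersection to the coset of [x]. *)
Lemma coset_top_join_discrete (tau : Topological H) :
  paratopological_group tau ->
  is_discrete (join_top (subspace_top (val : G -> H) tau) sigma) ->
  is_discrete (join_top tau (coset_top sigma)).
Proof.
move=> tau_para join_d A; rewrite openE => x Ax; apply/nbhs_joinP.
have /nbhs_joinP[U0 [V [U01 V1 UV]]] :
    nbhs (1 : Topological.Pack (join_top (subspace_top (val : G -> H) tau) sigma))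
      [set 1].
  by apply: open_nbhs_nbhs; split=> //; exact: join_d.
move: U01; rewrite nbhsE => -[_ [[U oU <-] U1] UU0].
exists [set y | U (x^-1 * y)], [set x * val g | g in V]; split.
- apply: nbhs_translate => //; rewrite mulVg -(val1 G).
  exact: (@open_nbhs_nbhs (Topological.Pack tau)).
- by apply/nbhs_cosetP; apply: filterS V1 => g Vg; exists g.
- move=> y [/= Uy [g Vg yE]]; move: Uy; rewrite -yE mulKg => Ug.
  by rewrite (UV g) ?val1 ?mulg1//; split=> //; exact: UU0.
Qed.

End CosetExtension.

Theorem corollary4p12
  (H : groupType) (tau : Topological H)
  (tau_para : paratopological_group tau) (tau_nondiscrete : ~ is_discrete tau)
  (P : {pred H}) (G : subGroupType P)
  (G_infinite : infinite_set [set: G]%classic)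
  (G_central : {in P, forall g : H, forall h : H, commute g h})
  (tauG : is_discrete (subspace_top (val : G -> H) tau) \/
    exists sigma : Topological G, paratopological_group sigma /\
      transversal_top (subspace_top (val : G -> H) tau) sigma) :
  exists sigma : Topological H,
    paratopological_group sigma /\ transversal_top tau sigma.
Proof.
(* Asking only for a discrete join, instead of transversality on [G], lets one argument serve both
   alternatives of [tauG]. *)
suff [sigma [sigma_para sigma_nd join_d]] : exists sigma : Topological G,
    [/\ paratopological_group sigma, ~ is_discrete sigma
      & is_discrete (join_top (subspace_top (val : G -> H) tau) sigma)].
  exists (coset_top sigma); split; first exact: coset_top_paratopological.
  split=> //; first exact: coset_top_nondiscrete.
  exact: coset_top_join_discrete.
case: tauG => [tauG_d|[sigma [sigma_para [_ sigma_nd join_d]]]]; last first.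
  by exists sigma.
(* The initial topology of a constant map is the indiscrete topology. *)
exists (subspace_top (fun _ : G => 1 : H) tau); split.
- by apply: continuous_comp_initial => x; exact: cst_continuous.
(* Were [[set 1]] open, it would be a nonempty preimage under a constant map, hence all of [G]. *)
- move=> /(_ [set 1]) [U _ UE]; apply: G_infinite.
  suff -> : [set: G] = [set 1] by exact: finite_set1.
  have U1 : U 1 by have : [set 1 : G] 1 by []; rewrite -UE.
  by rewrite -UE predeqE => g; split.
- exact: discrete_joinl.
Qed.
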